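(* Let $E \subset \mathbb{C}$ be any (nonempty) finite union of pairwise disjoint Jordan domains in $\mathbb{C}$. For any $\epsilon > 0$, there exists a polynomial $P$ (with complex coefficients) such that $$d\left(E, \mathcal{K}(P)\right) < \epsilon, \quad d\left(\partial E, \mathcal{J}(P)\right) < \epsilon, \quad \text{and} \quad d\left(\hat{\mathbb{C}} \setminus E, \hat{\mathbb{C}} \setminus \mathcal{K}(P)\right) < \epsilon.$$
   Context: $\hat{\mathbb{C}} = \mathbb{C} \cup \{\infty\}$ is the Riemann sphere. A Jordan domain in $\mathbb{C}$ is the bounded connected component of the complement of a Jordan curve (simple closed curve) in $\mathbb{C}$. For a polynomial $P$, $P^m$ denotes the $m$-th iterate; the filled Julia set is $\mathcal{K}(P) = \{z \in \mathbb{C} : P^m(z) \nrightarrow \infty \text{ as } m \to \infty\}$, and the Julia set is $\mathcal{J}(P) = \partial \mathcal{K}(P)$. $d$ denotes the Hausdorff metric: for nonempty sets $A, B$, $d(A,B)$ is the infimum of all $r > 0$ such that every point of $A$ is within distance $r$ of some point of $B$ and every point of $B$ is within distance $r$ of some point of $A$. Distances between points of $\mathbb{C}$ are Euclidean; for subsets of $\hat{\mathbb{C}}$ containing $\infty$, the point $\infty$ is regarded as at distance $0$ from itself and at infinite distance from every point of $\mathbb{C}$. *)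

(* Defs.v *)
From HB Require Import structures.
From mathcomp Require Import all_boot all_order all_algebra.
From mathcomp Require Import all_classical all_reals all_analysis.
From mathcomp Require Import complex.
Set Implicit Arguments.
Unset Strict Implicit.
Unset Printing Implicit Defensive.
Import Order.TTheory GRing.Theory Num.Theory numFieldNormedType.Exports.
Local Open Scope classical_set_scope.
Local Open Scope complex_scope.
Local Open Scope ring_scope.

(* The alias [^o] is what gives [R[i]] its normed topology: there is no
   topological structure on [R[i]] itself. *)
Notation cplx R := (R[i]^o).
Notation sphere R := (one_point_compactification (cplx R)).

(* The library norm on [R[i]] is [R[i]]-valued; [modulus] is [R]-valued. *)
Definition modulus (R : realType) (z : cplx R) : R :=
  ComplexField.Normc.normc z.

Definition boundary (T : topologicalType) (A : set T) : set T :=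
  closure A `\` interior A.

(* Closed curves are parametrized by [0, 1] with equal values at 0 and 1. *)
Definition jordan_curve (R : realType) (J : set (cplx R)) : Prop :=
  exists g : R -> cplx R,
    [/\ {within `[0, 1], continuous g},
        g 0 = g 1,
        {in `[0, 1[ &, injective g} &
        J = g @` `[0, 1]].

Definition jordan_domain (R : realType) (D : set (cplx R)) : Prop :=
  exists J : set (cplx R),
    [/\ jordan_curve J,
        exists2 x, (~` J) x & D = connected_component (~` J) x &
        bounded_set D].

Definition filled_julia (R : realType) (P : {poly R[i]}) : set (cplx R) :=
  [set z | ~ (modulus (iter m (horner P) z) @[m --> \oo] --> +oo)].

Definition julia (R : realType) (P : {poly R[i]}) : set (cplx R) :=
  boundary (filled_julia P).

Definition plane_dist (R : realType) (x y : cplx R) : \bar R :=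
  (modulus (x - y))%:E.

Definition sphere_dist (R : realType) (x y : sphere R) : \bar R :=
  match x, y with
  | Some a, Some b => plane_dist a b
  | None, None => 0%E
  | _, _ => +oo%E
  end.

(* The infimum of the empty set is [+oo]. *)
Definition hausdorff_dist (R : realType) (T : Type) (dist : T -> T -> \bar R)
    (A B : set T) : \bar R :=
  ereal_inf [set r%:E | r in [set r : R | [/\ 0 < r,
    forall a, A a -> exists2 b, B b & (dist a b <= r%:E)%E &
    forall b, B b -> exists2 a, A a & (dist b a <= r%:E)%E]]].

Definition sphere_compl (R : realType) (A : set (cplx R)) : set (sphere R) :=
  ~` (Some @` A).

(* Main.v *)
Require Import Defs.
From HB Require Import structures.
From mathcomp Require Import all_boot all_order all_algebra.
From mathcomp Require Import all_classical all_reals all_analysis.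
From mathcomp Require Import complex ring lra zify.
Import Order.TTheory GRing.Theory Num.Theory numFieldNormedType.Exports.
Set Implicit Arguments.
Unset Strict Implicit.
Unset Printing Implicit Defensive.
Local Open Scope classical_set_scope.
Local Open Scope complex_scope.
Local Open Scope ring_scope.

(** Fix a small [d > 0] and let [F] be the core of [E], the compact set of points
    at distance at least [d] from the complement of [E]. It suffices to find a
    polynomial [P] whose filled Julia set [K] satisfies [F <= K <= E]. Indeed [F]
    is Hausdorff-close to [E], every point outside [F] is close to a point outside
    [E], and boundaries are compared by means of short segments: a segment from a
    point of a set to a point of its complement meets the boundary of the set
    ([hausdorff_core_approximation]).

    Such a [P] comes from a polynomial [Q] that is small on [F] and large off [E].
    If [|Q| <= 1/2] on [F], [|Q| >= 2] off [E], [c] is well inside [F] and [N] is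
    large, then [P = c + ('X - c) * Q ^+ N] contracts [F] into a small disc around
    [c], and sends every point off [E] to another one whose distance to [c] is at
    least twice as large ([lemniscate_filled_julia]).

    That [Q] exists is Hilbert's lemniscate theorem ([lemniscate]): [Q] is a
    multiple of the monic polynomial [L] whose roots form a list [s] of [n] points
    of [F] that almost maximizes the product [distprod s] of the mutual distances.
    Write [V n] for the supremum of these products. Up to constant factors, adding
    a point of [F] to [s] bounds [|L|] on [F] by [V n.+1 / V n], while removing one
    bounds the modulus of the derivative of [L] at the points of [s] from below by
    [V n / V n.-1]. The ratio of these bounds stays bounded for infinitely many
    [n], for otherwise [V n.+1 / V n] would grow faster than the [n]-th power of
    the diameter of [F] ([slowly_growing_ratio]). Suppose that a polynomial [q]
    satisfies [|q| <= 1] on [F] and [|q| >= 2] at [w]. Lagrange interpolation at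
    the points of [s] of a large power of [q] then shows that [|L|] is much larger
    at [w] than on [F] ([fekete_lower]).

    It remains to find such a [q] for each [w] off [E]. It exists when [w] is far
    away, and if it exists for [w0] off [E], it exists for all points at distance
    at most [d / 5] from [w0] ([poly_separated_step], the pole-pushing argument of
    Runge's theorem). So the points off [E] without a [q] form a bounded set at
    positive distance from the other points off [E]. Such a set must be empty
    ([jordan_domains_complement]). The reason is a discrete form of the
    unicoherence of the plane: for one Jordan domain [D], the function that counts
    modulo 2 the crossings of the boundary of [D] near that set is a cocycle on
    short steps, hence a coboundary since the plane is simply connected; as [D]
    and its complement are connected, the boundary of [D] cannot lie partly near
    the set and partly away from it. Adding to the set the domains whose boundary
    is near it gives a bounded part of the plane at positive distance from the
    rest, hence an empty one. *)

(** * The modulus and the topology it defines *)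

Section Modulus.
Variable R : realType.
Implicit Types (x y z w : R[i]) (e r : R).

Lemma normr_modulus z : `|z| = (modulus z)%:C.
Proof. by []. Qed.

Lemma modulus0 : modulus (0 : R[i]) = 0.
Proof. exact: ComplexField.Normc.normc0. Qed.

Lemma modulus1 : modulus (1 : R[i]) = 1.
Proof. exact: ComplexField.Normc.normc1. Qed.

Lemma modulusM x y : modulus (x * y) = modulus x * modulus y.
Proof. exact: ComplexField.Normc.normcM. Qed.

Lemma modulusV x : modulus x^-1 = (modulus x)^-1.
Proof. exact: ComplexField.Normc.normcV. Qed.

Lemma modulusN x : modulus (- x) = modulus x.
Proof. exact: normcN. Qed.

Lemma modulusBC x y : modulus (x - y) = modulus (y - x).
Proof. by rewrite -modulusN opprB. Qed.

Lemma modulusD x y : modulus (x + y) <= modulus x + modulus y.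
Proof. exact: le_normcD. Qed.

Lemma modulus_ge0 x : 0 <= modulus x.
Proof. by case: x => a b; exact: sqrtr_ge0. Qed.

Lemma modulus_eq0 x : (modulus x == 0) = (x == 0).
Proof.
apply/eqP/eqP => [|->]; [exact: ComplexField.Normc.eq0_normc|exact: modulus0].
Qed.

Lemma modulus_gt0 x : (0 < modulus x) = (x != 0).
Proof. by rewrite lt_neqAle modulus_ge0 andbT eq_sym modulus_eq0. Qed.

Lemma modulusX x n : modulus (x ^+ n) = modulus x ^+ n.
Proof. by elim: n => [|n IH]; rewrite ?expr0 ?modulus1// !exprS modulusM IH. Qed.

Lemma modulus_real r : modulus (r%:C) = `|r|.
Proof. by rewrite /modulus /= expr0n addr0 sqrtr_sqr. Qed.

Lemma modulus_triangle x y z : modulus (x - z) <= modulus (x - y) + modulus (y - z).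
Proof. by rewrite -(subrKA y x); exact: modulusD. Qed.

Lemma modulus_sub_ge x y : modulus x - modulus y <= modulus (x - y).
Proof. by rewrite lerBlDr -{1}(subrK y x) modulusD. Qed.

Lemma Re_le_modulus x : `|complex.Re x| <= modulus x.
Proof. by rewrite -lecR; exact: normc_ge_Re. Qed.

(** The library norm of [R[i]] takes values in [R[i]], whose positive elements are
    the positive reals; hence real radii suffice. *)
Lemma nbhs_modulusP (z : cplx R) (A : set (cplx R)) :
  nbhs z A <-> exists2 e : R, 0 < e & forall w : R[i], modulus (w - z) < e -> A w.
Proof.
split=> [/nbhs_ballP[e /= e0 H]|[e e0 H]].
  have e_real : e = (complex.Re e)%:C.
    by move: e0; case: e {H} => a b; rewrite ltcE /= => /andP[/eqP -> _].
  move: e0 H; rewrite e_real ltcR => e0 H; exists (complex.Re e) => // w wz.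
  by apply: H; rewrite -ball_normE /= distrC normr_modulus ltcR.
apply/nbhs_ballP; exists (e%:C); first by rewrite /= ltcR.
by move=> w; rewrite -ball_normE /= distrC normr_modulus ltcR; exact: H.
Qed.

End Modulus.

(** * Segments, connectedness and compactness in the plane *)

Section PlaneTopology.
Variable R : realType.
Implicit Types (x y z w : R[i]) (e r : R).

Lemma open_enlargement (S : set R[i]) e :
  open ([set z | exists2 y, S y & modulus (z - y) < e] : set (cplx R)).
Proof.
rewrite openE => z [y Sy zy]; apply/nbhs_modulusP.
exists (e - modulus (z - y)); first by rewrite subr_gt0.
move=> w wz; exists y => //.
by apply: le_lt_trans (modulus_triangle _ z _) _; rewrite -ltrBrDr.
Qed.

(** A uniform form of connectedness: a function that does not change on steps
    shorter than [e] inside a connected set is constant on it, since its level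
    sets are relatively open and closed. It is stated for arbitrary values [T] so
    that it applies to booleans as well as to propositions. *)
Lemma connected_chain_const (T : Type) (S : set (cplx R)) (g : R[i] -> T) e :
  connected S -> 0 < e ->
  (forall x y, S x -> S y -> modulus (x - y) < e -> g x = g y) ->
  forall x y, S x -> S y -> g x = g y.
Proof.
move=> cS e0 gloc x y Sx Sy.
pose near P := [set z | exists2 y, (S `&` P) y & modulus (z - y) < e].
have sub0 z : modulus (z - z) < e by rewrite subrr modulus0.
suff: [set z | S z /\ g x = g z] = S.
  by move/seteqP => [_ /(_ _ Sy)[]].
apply: cS.
- by exists x.
- exists (near [set z | g x = g z]); first exact: open_enlargement.
  apply/seteqP; split=> z [Sz gz]; split=> //; first by exists z.
  by case: gz => w [Sw gw] zw; rewrite gw; apply: gloc => //; rewrite modulusBC.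
- exists (~` near [set z | g x <> g z]).
    exact/open_closedC/open_enlargement.
  apply/seteqP; split=> z [Sz gz]; split=> //.
    move=> [w [Sw /= gw] zw]; apply: gw; rewrite gz; exact: gloc.
  by apply: contrapT => gxz; apply: gz; exists z.
Qed.

Definition segment_point x y (t : R) : R[i] := x + t%:C * (y - x).

Lemma segment_point0 x y : segment_point x y 0 = x.
Proof. by rewrite /segment_point mul0r addr0. Qed.

Lemma segment_point1 x y : segment_point x y 1 = y.
Proof. by rewrite /segment_point mul1r addrC subrK. Qed.

Lemma segment_point_dist x y s t :
  modulus (segment_point x y s - segment_point x y t) =
  `|s - t| * modulus (y - x).
Proof.
rewrite /segment_point opprD addrACA subrr add0r -mulrBl -rmorphB.
by rewrite modulusM modulus_real.
Qed.

Lemma modulus_segment_point x y t : 0 <= t <= 1 ->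
  modulus (segment_point x y t) <= (1 - t) * modulus x + t * modulus y.
Proof.
move=> /andP[t0 t1]; have -> : segment_point x y t = (1 - t)%:C * x + t%:C * y.
  by rewrite /segment_point rmorphB /=; ring.
apply: le_trans (modulusD _ _) _; rewrite !modulusM !modulus_real.
by rewrite !ger0_norm ?subr_ge0.
Qed.

Definition segment x y : set (cplx R) := segment_point x y @` `[0, 1].

Lemma segment_l x y : segment x y x.
Proof. by exists 0; rewrite ?segment_point0//= in_itv/= lexx ler01. Qed.

Lemma segment_r x y : segment x y y.
Proof. by exists 1; rewrite ?segment_point1//= in_itv/= lexx ler01. Qed.

Lemma segment_dist_l x y z : segment x y z -> modulus (z - x) <= modulus (y - x).
Proof.
move=> [t /=]; rewrite in_itv /= => /andP[t0 t1] <-.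
rewrite -{2}(segment_point0 x y) segment_point_dist subr0 ger0_norm//.
by rewrite ler_piMl ?modulus_ge0.
Qed.

Lemma segment_dist_r x y z : segment x y z -> modulus (z - y) <= modulus (y - x).
Proof.
move=> [t /=]; rewrite in_itv /= => /andP[t0 t1] <-.
rewrite -{2}(segment_point1 x y) segment_point_dist distrC ger0_norm ?subr_ge0//.
by rewrite ler_piMl ?modulus_ge0// gerBl.
Qed.

Lemma segment_modulus_le x y z M : segment x y z ->
  modulus x <= M -> modulus y <= M -> modulus z <= M.
Proof.
move=> [t /=]; rewrite in_itv /= => /andP[t0 t1] <- xM yM.
apply: le_trans (modulus_segment_point _ _ _) _; first by rewrite t0.
have -> : M = (1 - t) * M + t * M by ring.
by apply: lerD; apply: ler_wpM2l; rewrite ?subr_ge0.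
Qed.

Lemma lipschitz_continuous (f : R -> cplx R) (L : R) :
  (forall s t, modulus ((f s : R[i]) - f t) <= `|s - t| * L) -> continuous f.
Proof.
move=> fL t; move=> A /nbhs_modulusP[e e0 Ae].
have L1 : 0 < `|L| + 1 by rewrite ltr_wpDl.
apply/nbhs_ballP; exists (e / (`|L| + 1)); first by rewrite /= divr_gt0.
move=> s; rewrite -ball_normE /= => ts; apply: Ae.
apply: le_lt_trans (fL _ _) _.
apply: (@le_lt_trans _ _ (`|s - t| * (`|L| + 1))).
  by apply: ler_wpM2l => //; rewrite (le_trans (ler_norm _))// lerDl.
by rewrite distrC -ltr_pdivlMr.
Qed.

Lemma connected_segment x y : connected (segment x y).
Proof.
apply: connected_continuous_connected; first exact: segment_connected.
apply: continuous_subspaceT; apply: (@lipschitz_continuous _ (modulus (y - x))).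
by move=> s t; rewrite segment_point_dist.
Qed.

Lemma closed_bounded_compact (K : set (cplx R)) M :
  closed K -> (forall z, K z -> modulus z <= M) -> compact K.
Proof.
move=> cK KM.
pose f (p : R * R) : cplx R := p.1 +i* p.2.
have fcont : continuous f.
  move=> [a b] A /nbhs_modulusP[e e0 Ae]; apply/nbhs_ballP.
  exists (e / 2); first by rewrite /= divr_gt0.
  move=> [c d] [/= ac bd]; apply: Ae; rewrite -[f _]/(c +i* d) -[f _]/(a +i* b).
  have -> : (c +i* d) - (a +i* b) = (c - a)%:C + 'i * (d - b)%:C :> R[i].
    by apply/eqP; rewrite eq_complex /=; apply/andP; split; apply/eqP; ring.
  apply: le_lt_trans (modulusD _ _) _; rewrite modulusM !modulus_real.
  have -> : modulus ('i : R[i]) = 1.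
    by rewrite /modulus /= expr0n add0r expr1n sqrtr1.
  rewrite mul1r (splitr e); apply: ltrD; rewrite distrC.
    exact: ac.
  exact: bd.
apply: (@subclosed_compact _ _ (f @` (`[- M, M] `*` `[- M, M]))) => //.
  apply: continuous_compact; first exact: continuous_subspaceT.
  by apply: compact_setX; exact: segment_compact.
move=> z Kz; exists (complex.Re z, complex.Im z); last by move: {Kz} z => [a b].
have Mz := KM _ Kz.
split; rewrite /= in_itv /= -ler_norml (le_trans _ Mz)//; first exact: Re_le_modulus.
move: (z : R[i]) => [a b] /=; rewrite /modulus /= -sqrtr_sqr ler_wsqrtr//.
by rewrite lerDr sqr_ge0.
Qed.

(** Compactness in the form used below: a property that holds locally from some
    index on holds on the whole of a compact set at a common index. *)
Lemma compact_uniform_index (K : set (cplx R)) (Q : nat -> R[i] -> Prop) :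
  compact K ->
  (forall z, K z -> exists k, exists2 e, 0 < e &
     forall w, modulus (w - z) < e -> forall k', (k <= k')%N -> Q k' w) ->
  exists k, forall z, K z -> Q k z.
Proof.
move=> /compact_near_coveringP cK loc.
have [] := cK nat \oo Q _ _.
  move=> z Kz; have [k [e e0 H]] := loc z Kz.
  exists ([set w : cplx R | modulus ((w : R[i]) - z) < e], [set k' | (k <= k')%N]).
    split; first by apply/nbhs_modulusP; exists e.
    by exists k.
  by move=> [w k'] [/= wz kk']; exact: H.
move=> k _ H; exists k => z Kz; exact: (H k (leqnn k) z Kz).
Qed.

Lemma bounded_set_modulus (D : set (cplx R)) : bounded_set D ->
  exists2 M, 0 < M & forall z, D z -> modulus z <= M.
Proof.
move=> /ex_strict_bound_gt0 [M M0 DM].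
have M_real : M = (complex.Re M)%:C.
  by move: M0; case: M {DM} => a b; rewrite ltcE /= => /andP[/eqP -> _].
move: M0 DM; rewrite M_real ltcR => M0 DM; exists (complex.Re M) => // z Dz.
by apply: ltW; have := DM z Dz; rewrite /= normr_modulus ltcR.
Qed.

(** The union of a component with a small disc around one of its points is
    connected and avoids [J]. *)
Lemma component_open (J : set (cplx R)) x : closed J ->
  open (connected_component (~` J) x).
Proof.
move=> cJ; rewrite openE => y Dy.
have nJy : (~` J) y by exact: connected_component_sub Dy.
have : nbhs y (~` J) by apply: open_nbhs_nbhs; split => //; exact: closed_openC.
move=> /nbhs_modulusP[e e0 He]; apply/nbhs_modulusP; exists e => // w wy.
apply: connected_component_trans Dy _.
apply: (@connected_component_max _ _ (segment y w)).
- exact: segment_l.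
- by move=> z /segment_dist_l zy; apply: He; exact: le_lt_trans zy wy.
- exact: connected_segment.
- exact: segment_r.
Qed.

End PlaneTopology.

(** * Complements of disjoint Jordan domains *)

Section Potential.
Variable R : realType.
Implicit Types (x y z w : R[i]).

(** The vanishing of the first cohomology of a disc with values modulo 2, at the
    scale [tau]. The potential at [x] sums the cocycle along the segment from [0]
    to [x], cut into [n.+1] short steps. For two neighbouring end points the two
    subdivided segments form a ladder of small triangles, and the cocycle relation
    telescopes along it. *)
Lemma cocycle_potential (c : R[i] -> R[i] -> bool) (M tau : R) :
  0 < tau ->
  (forall x y z, modulus x <= M -> modulus y <= M -> modulus z <= M ->
     modulus (x - y) < tau -> modulus (y - z) < tau -> modulus (x - z) < tau ->
     c x z = c x y (+) c y z) ->
  exists g : R[i] -> bool, forall x y, modulus x <= M -> modulus y <= M ->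
    modulus (x - y) < tau / 2 -> c x y = g x (+) g y.
Proof.
move=> tau0 coc.
have [n Mn] : exists n : nat, M / n.+1%:R < tau / 2.
  exists (Num.truncn (M / (tau / 2))).
  by rewrite ltr_pdivrMr// mulrC -ltr_pdivrMr ?divr_gt0// truncnS_gt.
pose p (k : nat) x : R[i] := (k%:R / n.+1%:R : R)%:C * x.
pose G k x := \big[addb/false]_(j < k) c (p j x) (p j.+1 x).
exists (G n.+1) => x y xM yM xy.
have pM k z : (k <= n.+1)%N -> modulus z <= M -> modulus (p k z) <= M.
  move=> kn zM; rewrite /p modulusM modulus_real ger0_norm ?divr_ge0//.
  apply: le_trans zM; rewrite ler_piMl ?modulus_ge0// ler_pdivrMr// mul1r ler_nat//.
have pS k z : modulus z <= M -> modulus (p k z - p k.+1 z) < tau / 2.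
  move=> zM; rewrite modulusBC /p -mulrBl -rmorphB -mulrBl modulusM modulus_real.
  rewrite -natrB ?leqnSn// subSnn mul1r ger0_norm ?invr_ge0//.
  by apply: le_lt_trans Mn; rewrite mulrC ler_pM2r ?invr_gt0.
have pxy k : (k <= n.+1)%N -> modulus (p k x - p k y) < tau / 2.
  move=> kn; apply: le_lt_trans xy.
  rewrite /p -mulrBr modulusM modulus_real ger0_norm ?divr_ge0//.
  by rewrite ler_piMl ?modulus_ge0// ler_pdivrMr// mul1r ler_nat.
have half : tau / 2 < tau by rewrite ltr_pdivrMr// mulr_natr mulr2n ltrDl.
have ltau a : a < tau / 2 -> a < tau by move=> /lt_trans; apply.
have GS k z : G k.+1 z = G k z (+) c (p k z) (p k.+1 z).
  by rewrite /G big_ord_recr.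
suff H k : (k <= n.+1)%N -> c (p k x) (p k y) = G k x (+) G k y.
  have := H n.+1 (leqnn _).
  by rewrite {1 2}/p divff ?pnatr_eq0//= !mul1r.
elim: k => [|k IH] kn.
  have p00 z : p 0%N z = 0 by rewrite /p !mul0r.
  rewrite /G !big_ord0 !p00.
  have M0 : modulus (0 : R[i]) <= M by rewrite -(p00 x); exact: pM.
  have := coc 0 0 0; rewrite subrr !modulus0.
  move=> /(_ _ _ _ tau0 tau0 tau0); rewrite -{1 2 3}(modulus0 R) => /(_ M0 M0 M0).
  by case: (c 0 0).
have kn' := ltnW kn.
have e1 : c (p k x) (p k.+1 y) = c (p k x) (p k y) (+) c (p k y) (p k.+1 y).
  apply: coc; try exact: pM; try (exact/ltau/pxy); try (exact/ltau/pS).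
  apply: le_lt_trans (modulus_triangle _ (p k y) _) _.
  by rewrite (splitr tau) ltrD ?pxy ?pS.
have e2 : c (p k x) (p k.+1 y) = c (p k x) (p k.+1 x) (+) c (p k.+1 x) (p k.+1 y).
  apply: coc; try exact: pM; try (exact/ltau/pxy); try (exact/ltau/pS).
  apply: le_lt_trans (modulus_triangle _ (p k y) _) _.
  by rewrite (splitr tau) ltrD ?pxy ?pS.
rewrite !GS.
move: (IH kn') e1 e2.
move: (c (p k x) (p k y)) (c (p k x) (p k.+1 y)) (c (p k y) (p k.+1 y)).
move: (c (p k x) (p k.+1 x)) (c (p k.+1 x) (p k.+1 y)) (G k x) (G k y).
by do 7 case.
Qed.

(** The boundary of [D] is in one piece. The hypothesis on [near] says that the
    indicator of a crossing of the boundary of [D] at a point where [near] holds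
    is a cocycle. Its potential is constant on [D], which is connected, and also on
    the complement, where each point is joined by a segment to the connected set
    [J]. So the cocycle takes the same value on all crossings. *)
Lemma crossing_constant (D J : set (cplx R)) (M tau : R) (near : R[i] -> bool) :
  0 < tau -> connected D -> connected J ->
  (forall x, D x -> modulus x <= M) ->
  (forall x, J x -> modulus x <= M /\ ~ D x) ->
  (forall y, ~ D y -> modulus y <= M ->
     exists2 p, J p & segment y p `<=` ~` D) ->
  (forall x y, D x -> ~ D y -> modulus (x - y) < tau -> near x = near y) ->
  exists beta, forall x y, D x -> ~ D y -> modulus y <= M ->
    modulus (x - y) < tau / 2 -> near x = beta.
Proof.
move=> tau0 cD cJ DM JM seg nearD.
pose d x : bool := `[< D x >].
have dT x : D x -> d x = true by move=> Dx; apply/asboolP.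
have dF x : ~ D x -> d x = false by move=> Dx; apply/asboolPn.
have dnear x y : modulus (x - y) < tau -> d x (+) d y -> near x = near y.
  move=> xy; case: (asboolP (D x)) => Dx; case: (asboolP (D y)) => Dy;
    rewrite ?(dT _ Dx) ?(dT _ Dy) ?(dF _ Dx) ?(dF _ Dy)// => _.
    exact: nearD.
  by apply/esym/nearD; rewrite // modulusBC.
pose c x y := (d x (+) d y) && near x.
have [g gc] : exists g : R[i] -> bool, forall x y, modulus x <= M ->
    modulus y <= M -> modulus (x - y) < tau / 2 -> c x y = g x (+) g y.
  apply: cocycle_potential => // x y z _ _ _ /dnear xy /dnear yz /dnear xz.
  move: xy yz xz; rewrite /c; case: (d x); case: (d y); case: (d z) => //=;
    case: (near x); case: (near y); case: (near z) => //= xy yz xz;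
    solve [by have := xy isT | by have := yz isT | by have := xz isT | by []].
have gD x y : D x -> D y -> g x = g y.
  apply: (@connected_chain_const _ _ _ _ (tau / 2)) => //; first exact: divr_gt0.
  move=> {}x {}y Dx Dy xy; have := gc x y (DM _ Dx) (DM _ Dy) xy.
  by rewrite /c !dT//=; case: (g x); case: (g y).
have gC (S : set (cplx R)) x y : connected S ->
    (forall z, S z -> modulus z <= M /\ ~ D z) -> S x -> S y -> g x = g y.
  move=> cS SM; apply: (@connected_chain_const _ _ _ _ (tau / 2)) => //.
    exact: divr_gt0.
  move=> {}x {}y Sx Sy xy; have [xM Dx] := SM _ Sx; have [yM Dy] := SM _ Sy.
  by have := gc x y xM yM xy; rewrite /c !dF//=; case: (g x); case: (g y).
have gCC y y' : ~ D y -> ~ D y' -> modulus y <= M -> modulus y' <= M -> g y = g y'.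
  have gJ z : ~ D z -> modulus z <= M -> exists2 p, J p & g z = g p.
    move=> Dz zM; have [p Jp zp] := seg z Dz zM; exists p => //.
    apply: (gC (segment z p)); first exact: connected_segment.
    - move=> w zpw; split; last exact: zp.
      by apply: (segment_modulus_le zpw) => //; have [] := JM p Jp.
    - exact: segment_l.
    - exact: segment_r.
  move=> Dy Dy' yM y'M; have [p Jp ->] := gJ _ Dy yM.
  have [p' Jp' ->] := gJ _ Dy' y'M; exact: (gC J).
have [[x0 Dx0]|D0] := pselect (exists x, D x); last first.
  by exists true => x y Dx; case: D0; exists x.
have [[y0 [Dy0 y0M]]|D0] := pselect (exists y, ~ D y /\ modulus y <= M); last first.
  by exists true => x y Dx Dy yM; case: D0; exists y.
exists (g x0 (+) g y0) => x y Dx Dy yM xy.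
rewrite (gD x0 x)// (gCC y0 y)// -gc//; last exact: DM.
by rewrite /c dT// dF.
Qed.

End Potential.

Section JordanDomains.
Variable R : realType.
Implicit Types (x y z w : R[i]).

Lemma jordan_curve_connected (J : set (cplx R)) : jordan_curve J -> connected J.
Proof.
move=> [g [gc _ _ ->]]; apply: connected_continuous_connected => //.
exact: segment_connected.
Qed.

Lemma jordan_curve_compact (J : set (cplx R)) : jordan_curve J -> compact J.
Proof.
move=> [g [gc _ _ ->]]; apply: continuous_compact => //; exact: segment_compact.
Qed.

Lemma jordan_curve_nonempty (J : set (cplx R)) : jordan_curve J -> J !=set0.
Proof.
by move=> [g [_ _ _ ->]]; exists (g 0), 0; rewrite //= in_itv /= lexx ler01.
Qed.

Lemma modulusB_continuous y : continuous (fun z : cplx R => modulus ((z : R[i]) - y)).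
Proof.
move=> z A /nbhs_ballP[e /= e0 Ae]; apply/nbhs_modulusP; exists e => // w wz.
apply: Ae; rewrite -ball_normE /= distrC; apply: le_lt_trans wz.
rewrite ler_norml; have := modulus_triangle w z y; have := modulus_triangle z w y.
rewrite (modulusBC z w) => ? ?; apply/andP; split; lra.
Qed.

Lemma closest_point (J : set (cplx R)) y : compact J -> J !=set0 ->
  exists2 p, J p & forall q, J q -> modulus (p - y) <= modulus (q - y).
Proof.
move=> cJ J0.
have [|p] := @compact_EVT_min _ _ (fun z : cplx R => modulus ((z : R[i]) - y)) J J0 cJ.
  by apply: continuous_subspaceT; exact: modulusB_continuous.
by rewrite inE => Jp H; exists p => // q Jq; apply: H; rewrite inE.
Qed.

Lemma compact_modulus_bounded (J : set (cplx R)) : compact J ->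
  exists M, forall z, J z -> modulus z <= M.
Proof.
move=> cJ; have [|k H] := 
  @compact_uniform_index R J (fun k z => modulus z <= k%:R) cJ _.
  move=> z _; exists (Num.truncn (modulus z + 1)).+1, 1 => // w wz k' kk'.
  apply: (@le_trans _ _ (modulus z + 1)).
    have := modulusD (w - z) z; rewrite subrK => /le_trans; apply.
    by rewrite addrC lerD2l ltW.
  apply: le_trans (ltW (truncnS_gt _)) _; by rewrite ler_nat.
by exists k%:R.
Qed.

(** Take the point [p] of [J] closest to [y]: the segment from [y] to [p] meets [J]
    only at [p], so the rest of it stays in the component of [y], which is not
    that of [x]. *)
Lemma component_visible (J : set (cplx R)) x y : compact J -> J !=set0 ->
  ~ connected_component (~` J) x y ->
  exists2 p, J p & segment y p `<=` ~` connected_component (~` J) x.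
Proof.
move=> cJ J0 xy; have [p Jp py] := closest_point y cJ J0.
exists p => // v [t /=]; rewrite in_itv /= => /andP[t0 t1] <- xz.
have nJz := connected_component_sub xz.
have t1' : t < 1.
  rewrite lt_neqAle t1 andbT; apply/eqP => t1E; apply: nJz.
  by rewrite t1E segment_point1.
apply: xy; apply: connected_component_trans xz _.
apply: connected_component_sym.
pose z := segment_point y p t.
apply: (@connected_component_max _ _ (segment y z)).
- exact: segment_l.
- move=> w /segment_dist_l wy Jw.
  have := le_trans (py w Jw) wy.
  have -> : modulus (z - y) = t * modulus (p - y).
    by rewrite /z /segment_point addrC addKr modulusM modulus_real ger0_norm.
  have [py0|] := eqVneq (p - y) 0; last first.
    by rewrite -modulus_gt0 => py0; rewrite ler_pMl// leNgt t1'.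
  move=> _; apply: nJz; rewrite /z /segment_point py0 mulr0 addr0.
  by move/eqP: py0; rewrite subr_eq0 => /eqP <-.
- exact: connected_segment.
- exact: segment_r.
Qed.

Lemma jordan_domain_open (D : set (cplx R)) : jordan_domain D -> open D.
Proof.
move=> [J [Jc [x Jx ->] _]]; apply: component_open.
by apply: compact_closed; [exact: norm_hausdorff|exact: jordan_curve_compact].
Qed.

Lemma jordan_crossing_constant (D : set (cplx R)) (tau : R) (near : R[i] -> bool) :
  jordan_domain D -> 0 < tau ->
  (forall x y, D x -> ~ D y -> modulus (x - y) < tau -> near x = near y) ->
  exists beta, forall x y, D x -> ~ D y -> modulus (x - y) < tau / 2 ->
    near x = beta.
Proof.
move=> [J [Jc [x0 Jx0 DE] Db]] tau0 nearD.
have [M M0 DM] := bounded_set_modulus Db.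
have cJ := jordan_curve_compact Jc.
have [M' JM'] := compact_modulus_bounded cJ.
pose L := Num.max (M + tau) M'.
have ML : M + tau <= L by rewrite le_max lexx.
have M'L : M' <= L by rewrite le_max lexx orbT.
have [|||||beta H] := @crossing_constant R D J L tau near tau0 _ _ _ _ _ nearD.
- by rewrite DE; exact: component_connected.
- exact: jordan_curve_connected.
- move=> x /DM xM; apply: le_trans ML; rewrite (le_trans xM)// lerDl ltW//.
- move=> x Jx; split; first exact: le_trans (JM' _ Jx) _.
  by rewrite DE => /connected_component_sub.
- move=> y Dy _; rewrite DE; apply: component_visible => //.
    exact: jordan_curve_nonempty.
  by rewrite -DE.
- exists beta => x y Dx Dy xy; apply: (H _ y) => //.
  apply: le_trans ML; rewrite -(subrK x y); apply: le_trans (modulusD _ _) _.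
  rewrite addrC lerD ?DM// modulusBC ltW// (lt_le_trans xy)//.
  by rewrite ler_pdivrMr// mulr_natr mulr2n lerDl ltW.
Qed.

(** The complement of a disjoint union of Jordan domains has no bounded part [B] at
    positive distance from its other points. By [jordan_crossing_constant], for
    each domain either all the short crossings of its boundary are near [B], or
    none is. The union [G] of [B] with the domains of the first kind is then stable
    under short steps, so it is empty or the whole plane; being bounded, it is
    empty. *)
Lemma jordan_domains_complement (I : Type) (D : I -> set (cplx R))
    (B : set (cplx R)) (tau M : R) :
  (forall i, jordan_domain (D i)) -> trivIset [set: I] D -> 0 < tau ->
  (forall i w, D i w -> modulus w <= M) ->
  (forall w, B w -> modulus w <= M /\ forall i, ~ D i w) ->
  (forall w w', B w -> (forall i, ~ D i w') -> modulus (w - w') < 4 * tau -> B w') ->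
  B = set0.
Proof.
move=> Dj Dd tau0 DM BM Bsep.
have D_inj i j x : D i x -> D j x -> i = j.
  by move=> Dix Djx; apply: Dd => //; exists x.
(* Otherwise [D i] and the union of the other domains would disconnect the
   segment. *)
have crossing i x y : D i x -> ~ D i y -> exists2 p, (forall j, ~ D j p) &
    segment x y p.
  move=> Dx Dy; apply: contrapT => noP.
  have cover z : segment x y z -> exists j, D j z.
    by move=> xyz; apply: contrapT => /forallNP Dz; apply: noP; exists z.
  have : segment x y `&` D i = segment x y.
    apply: connected_segment.
    - by exists x; split=> //; exact: segment_l.
    - by exists (D i) => //; exact: jordan_domain_open.
    - exists (~` \bigcup_(j in [set j | j <> i]) D j).
        by apply: open_closedC; apply: bigcup_open => j _; exact: jordan_domain_open.
      apply/seteqP; split=> z [xyz Dz]; split=> //.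
        by move=> [j /= ji Djz]; apply: ji; exact: D_inj Djz Dz.
      have [j Djz] := cover z xyz.
      have [<-//|ji] := pselect (j = i); by case: Dz; exists j.
  by move/seteqP => [_ /(_ y (segment_r x y))[_ /Dy]].
pose near x := `[< exists2 b, B b & modulus (x - b) < 2 * tau >].
have near_cross i x y : D i x -> ~ D i y -> modulus (x - y) < tau -> near x = near y.
  move=> Dx Dy xy; have [p Dp xyp] := crossing i x y Dx Dy.
  have xp : modulus (x - p) < tau.
    by rewrite modulusBC; apply: le_lt_trans (segment_dist_l xyp) _; rewrite modulusBC.
  have yp : modulus (y - p) < tau.
    by rewrite modulusBC; apply: le_lt_trans (segment_dist_r xyp) _; rewrite modulusBC.
  have nearp z : modulus (z - p) < tau -> near z = `[< B p >].
    move=> zp; apply/asboolP/asboolP => [[b Bb zb]|Bp]; last first.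
      by exists p => //; lra.
    apply: Bsep Bb Dp _; have := modulus_triangle b z p; rewrite (modulusBC b z); lra.
  by rewrite !nearp.
have /choice[beta betaP] : forall i, exists beta, forall x y, D i x -> ~ D i y ->
    modulus (x - y) < tau / 2 -> near x = beta.
  by move=> i; apply: jordan_crossing_constant => // x y; exact: near_cross.
pose G x := B x \/ exists2 i, D i x & beta i.
have nearB b y : B b -> modulus (b - y) < tau / 2 -> near y.
  by move=> Bb bY; apply/asboolP; exists b => //; rewrite modulusBC; lra.
(* The short crossings of the boundary of a domain of the second kind are far from
   [B], and those of a domain of the first kind lead to [B] or to another domain of
   the first kind. *)
have Gloc x y : modulus (x - y) < tau / 2 -> G x -> G y.
  move=> xy; have yx : modulus (y - x) < tau / 2 by rewrite modulusBC.
  have [[j Djy]|Dy] := pselect (exists j, D j y).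
    move=> [Bx|[i Dix bi]].
      right; exists j => //; rewrite -(betaP j y x)//; first exact: nearB Bx xy.
      by have [_] := BM _ Bx; apply.
    have [ij|ij] := pselect (i = j); first by right; exists j => //; rewrite -ij.
    have Diy : ~ D i y by move=> Diy; apply: ij; exact: D_inj Diy Djy.
    have Djx : ~ D j x by move=> Djx; apply: ij; exact: D_inj Dix Djx.
    right; exists j => //; rewrite -(betaP j y x)// -(near_cross i x y)//; last lra.
    by rewrite (betaP i x y).
  move/forallNP : Dy => Dy [Bx|[i Dix bi]]; left; first by apply: Bsep Bx Dy _; lra.
  have : near y by rewrite -(near_cross i x y)// ?(betaP i x y)//; lra.
  by move=> /asboolP[b Bb yb]; apply: Bsep Bb Dy _; rewrite modulusBC; lra.
rewrite -subset0 => b Bb.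
pose f : R[i] := (`|M| + 1)%:C.
have fM : ~ modulus f <= M.
  rewrite modulus_real ger0_norm ?addr_ge0//; have := ler_norm M; lra.
have : G b = G f :> Prop.
  have /(_ G (tau / 2)) :=
    @connected_chain_const R Prop _ _ _ (@connected_segment R b f).
  apply=> //; [exact: divr_gt0| |exact: segment_l|exact: segment_r].
  move=> x y _ _ xy; apply/propext; split; apply: Gloc => //; by rewrite modulusBC.
have Gb : G b by left.
rewrite propeqE => -[/(_ Gb) [/BM[]//|[i /DM]//] _].
Qed.

End JordanDomains.

(** * Separating points from a compact set by polynomials *)

Section Separation.
Variable R : realType.
Implicit Types (x y z w : R[i]) (F E : set R[i]).

(** Passing to powers of [q], any constant below [1] can replace [1 / 2]. *)
Definition poly_separated F w := exists2 q : {poly R[i]}, q.[w] = 1 &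
  forall z, F z -> modulus q.[z] <= 1 / 2.

Lemma poly_separated_far F M w : 0 < M -> (forall z, F z -> modulus z <= M) ->
  2 * M <= modulus w -> poly_separated F w.
Proof.
move=> M0 FM Mw; have w0 : w != 0 by rewrite -modulus_gt0; lra.
exists (w^-1 *: 'X); first by rewrite hornerZ hornerX mulVf.
move=> z /FM zM; rewrite hornerZ hornerX modulusM modulusV mulrC.
by rewrite ler_pdivrMr; lra.
Qed.

(** Let [q] separate [w0] from [F]. The polynomial [p = (1 - q ^+ 2) / ('X - w0)]
    is close to [1 / ('X - w0)] on [F]. It is also close to [1 / ('X - w)] there
    when [w] is close to [w0], so that [1 - ('X - w) * p], which is [1] at [w], is
    small on [F]. *)
Lemma poly_separated_step F w0 w (rho : R) : 0 < rho ->
  (forall z, F z -> rho <= modulus (z - w0)) -> modulus (w - w0) <= rho / 5 ->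
  poly_separated F w0 -> poly_separated F w.
Proof.
move=> rho0 Frho ww0 [q qw0 qF].
have /factor_theorem[p pE] : root (1 - q ^+ 2) w0.
  by rewrite /root !hornerE qw0 expr1n subrr.
exists (1 - ('X - w%:P) * p); first by rewrite !hornerE subrr mul0r subr0.
move=> z Fz; rewrite !hornerE.
have pz : p.[z] * (z - w0) = 1 - q.[z] ^+ 2.
  by have := congr1 (horner^~ z) pE; rewrite !hornerE.
have -> : 1 - (z - w) * p.[z] = q.[z] ^+ 2 + (w - w0) * p.[z].
  have -> : q.[z] ^+ 2 = 1 - p.[z] * (z - w0) by rewrite pz; ring.
  by ring.
have q2 : modulus q.[z] ^+ 2 <= 1 / 4.
  have := qF z Fz; have := modulus_ge0 q.[z]; nra.
have h1 : modulus p.[z] * modulus (z - w0) <= 5 / 4.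
  rewrite -modulusM pz; apply: le_trans (modulusD _ _) _.
  rewrite modulus1 modulusN modulusX; lra.
apply: le_trans (modulusD _ _) _; rewrite modulusX modulusM.
have := Frho z Fz; have := modulus_ge0 p.[z]; have := modulus_ge0 (w - w0).
move: (modulus p.[z]) (modulus (z - w0)) (modulus (w - w0)) ww0 h1.
move=> a b c ca ab c0 a0 rb.
have : c * a <= rho / 5 * a by rewrite ler_wpM2r.
have : rho * a <= b * a by rewrite ler_wpM2r.
lra.
Qed.

Definition core E (d : R) : set R[i] :=
  [set z | forall w, ~ E w -> d <= modulus (z - w)].

Lemma core_sub E d : 0 < d -> core E d `<=` E.
Proof.
move=> d0 z Hz; apply: contrapT => /Hz; rewrite subrr modulus0; lra.
Qed.

(** Polynomial convexity of the core. The points off [E] that are not separated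
    from it form a bounded set by [poly_separated_far], at distance more than
    [d / 5] from the other points off [E] by [poly_separated_step]. *)
Lemma jordan_domains_separated (I : Type) (D : I -> set (cplx R)) (M d : R) w :
  (forall i, jordan_domain (D i)) -> trivIset [set: I] D -> 0 < d ->
  0 < M -> (forall z, (\bigcup_i D i) z -> modulus z <= M) ->
  ~ (\bigcup_i D i) w -> poly_separated (core (\bigcup_i D i) d) w.
Proof.
move=> Dj Dd d0 M0 EM Ew; set E := \bigcup_i D i in EM Ew *.
have FM z : core E d z -> modulus z <= M by move=> /(core_sub d0)/EM.
pose B : set (cplx R) := [set w | ~ E w /\ ~ poly_separated (core E d) w].
have B0 : B = set0.
  apply: (@jordan_domains_complement R I D B (d / 20) (2 * M)) => //.
  - lra.
  - move=> i z Diz; have : modulus z <= M by apply: EM; exists i.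
    lra.
  - move=> z [Ez nz]; split; last by move=> i Diz; apply: Ez; exists i.
    rewrite leNgt; apply/negP => Mz; apply: nz; apply: (poly_separated_far M0 FM).
    exact: ltW.
  - move=> z z' [Ez nz] Dz' zz'; split; first by move=> [i _ /Dz'].
    move=> pz'; apply: nz; apply: (poly_separated_step d0 _ _ pz'); last by lra.
    by move=> x Fx; apply: Fx => -[i _ /Dz'].
apply: contrapT => npw; have : B w by [].
by rewrite B0.
Qed.

Lemma horner_locally_lipschitz (q : {poly R[i]}) w :
  exists2 L, 0 < L & forall v, modulus (v - w) <= 1 ->
    modulus (q.[v] - q.[w]) <= L * modulus (v - w).
Proof.
elim/poly_ind: q => [|q c [L L0 IH]].
  by exists 1 => // v _; rewrite !horner0 subrr modulus0 mul1r modulus_ge0.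
exists (L * (modulus w + 1) + modulus q.[w]) => [|v vw].
  by rewrite ltr_wpDr ?modulus_ge0// mulr_gt0// ltr_wpDl ?modulus_ge0.
rewrite !hornerE.
have -> : q.[v] * v + c - (q.[w] * w + c) = (q.[v] - q.[w]) * v + q.[w] * (v - w).
  by ring.
apply: le_trans (modulusD _ _) _; rewrite !modulusM mulrDl lerD2r mulrAC.
apply: ler_pM; rewrite ?modulus_ge0 ?IH//.
by have := modulusD (v - w) w; rewrite subrK; lra.
Qed.

(** If [q] is [1] at [w] and at most [1/2] on [F], then [4 *: q ^+ 2] is [4] at [w]
    and at most [1] on [F], so it still separates the points near [w]; compactness
    bounds the degrees. *)
Lemma poly_separated_uniform F (K : set (cplx R)) : compact K ->
  (forall w, K w -> poly_separated F w) ->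
  exists k, forall w, K w -> exists q : {poly R[i]},
    [/\ (size q <= k)%N, forall z, F z -> modulus q.[z] <= 1 &
        2 <= modulus q.[w]].
Proof.
move=> cK Kp; apply: (compact_uniform_index cK) => w /Kp[q qw qF].
have m4 : modulus (4 : R[i]) = 4.
  have -> : (4 : R[i]) = (4 : R)%:C by rewrite rmorph_nat.
  by rewrite modulus_real ger0_norm.
pose p : {poly R[i]} := 4 *: q ^+ 2.
have pE z : p.[z] = 4 * q.[z] ^+ 2 by rewrite hornerZ horner_exp.
have [L L0 Lip] := horner_locally_lipschitz p w.
exists (size p), (Num.min 1 (2 / L)); first by rewrite lt_min ltr01 divr_gt0.
move=> v; rewrite lt_min => /andP[v1 vL] k pk; exists p; split=> //.
- move=> z /qF qz; rewrite pE modulusM modulusX m4; have := modulus_ge0 q.[z]; nra.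
- have := Lip v (ltW v1); have := modulus_sub_ge p.[w] p.[v].
  rewrite {1}pE qw expr1n mulr1 m4 (modulusBC p.[w]).
  by move: vL; rewrite ltr_pdivlMr// mulrC; lra.
Qed.

End Separation.

(** * Fekete polynomials and lemniscates *)

Section RealSequences.
Variable R : realType.

Lemma exp_beats_linear (A : R) : 0 <= A -> exists m0, forall m, (m0 <= m)%N ->
  A * m.+1%:R <= 2 ^+ m.
Proof.
move=> A0; pose j := Num.truncn (2 * A); exists (2 * j.+1)%N.
have lin (k : nat) : k.+1%:R <= 2 ^+ k :> R by rewrite -natrX ler_nat ltn_expl.
have start : A * (2 * j.+1).+1%:R <= 2 ^+ (2 * j.+1) :> R.
  have jA : 2 * A <= 2 ^+ j.+1.
    apply: le_trans (ltW (truncnS_gt _)) _; apply: le_trans (lin _).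
    by rewrite ler_nat.
  apply: (@le_trans _ _ (2 * A * j.+2%:R)).
    by rewrite (mulrC 2) -mulrA -natrM ler_wpM2l// ler_nat; lia.
  by rewrite mul2n -addnn exprD ler_pM// mulr_ge0.
move=> m /subnK <-; elim: (m - _)%N => [//|k IH].
rewrite addSn exprS mulr_natl mulr2n; apply: (le_trans _ (lerD IH IH)).
by rewrite -mulrDr ler_wpM2l// -natrD ler_nat; lia.
Qed.

(** Otherwise the ratios [r n = v n.+1 / v n] would satisfy [r n.+1 >= 2 K r n] from
    [N] on, against the bound [r n <= K ^+ n]. *)
Lemma slowly_growing_ratio (v : nat -> R) (K : R) : 1 <= K ->
  (forall n, 0 < v n) -> (forall n, v n.+1 <= K ^+ n * v n) ->
  forall N, exists2 n, (N <= n)%N & v n.+2 * v n <= 2 * K * v n.+1 ^+ 2.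
Proof.
move=> K1 v0 vK N; apply: contrapT => H.
have big n : (N <= n)%N -> 2 * K * v n.+1 ^+ 2 < v n.+2 * v n.
  by move=> Nn; rewrite ltNge; apply/negP => h; apply: H; exists n.
have K0 : 0 < K by lra.
pose r n := v n.+1 / v n.
have r0 n : 0 < r n by rewrite divr_gt0.
have rK n : r n <= K ^+ n by rewrite ler_pdivrMr.
have rS n : (N <= n)%N -> 2 * K * r n <= r n.+1.
  move=> /big h; rewrite /r ler_pdivlMr//.
  have -> : 2 * K * (v n.+1 / v n) * v n.+1 = 2 * K * v n.+1 ^+ 2 / v n by ring.
  by rewrite ler_pdivrMr// ltW.
have rj j : (2 * K) ^+ j * r N <= r (N + j)%N.
  elim: j => [|j IH]; first by rewrite expr0 mul1r addn0.
  rewrite addnS; apply: le_trans (rS _ (leq_addr _ _)).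
  by rewrite exprS -mulrA ler_pM2l// mulr_gt0.
have small j : 2 ^+ j * r N <= K ^+ N.
  have := le_trans (rj j) (rK _).
  by rewrite exprMn exprD (mulrC (K ^+ N)) -mulrA mulrCA ler_pM2l// exprn_gt0.
pose j := Num.truncn (K ^+ N / r N).
have := small j.+1; apply/negP; rewrite -ltNge -ltr_pdivrMr//.
apply: lt_le_trans (truncnS_gt _) _; rewrite -natrX ler_nat ltnW// ltn_expl//.
Qed.

End RealSequences.

Section Fekete.
Variable R : realType.
Implicit Types (x y z w : R[i]) (F : set R[i]) (s : seq R[i]).

(** The modulus of the Vandermonde determinant of [s]. *)
Fixpoint distprod s : R :=
  if s is x :: s' then (\prod_(y <- s') modulus (x - y)) * distprod s' else 1.

Lemma distprod_ge0 s : 0 <= distprod s.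
Proof.
elim: s => //= x s IH; rewrite mulr_ge0//; apply: prodr_ge0 => y _; exact: modulus_ge0.
Qed.

Lemma distprod_gt0 s : uniq s -> 0 < distprod s.
Proof.
elim: s => //= x s IH /andP[xs us]; rewrite mulr_gt0 ?IH// big_seq.
apply: prodr_gt0 => y ys; rewrite modulus_gt0 subr_eq0.
by apply: contraNneq xs => ->.
Qed.

Lemma distprod_rem s x : x \in s ->
  distprod s = (\prod_(y <- rem x s) modulus (x - y)) * distprod (rem x s).
Proof.
elim: s => //= a s IH; rewrite inE; case: (eqVneq a x) => [->//|ax /= xs].
rewrite IH// !big_cons /= (perm_big _ (perm_to_rem xs)) /= big_cons.
by rewrite (modulusBC x a); ring.
Qed.

Lemma distprod_uniq s : 0 < distprod s -> uniq s.
Proof.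
elim: s => //= x s IH; case: (boolP (x \in s)) => [xs|xs h].
  rewrite (perm_big _ (perm_to_rem xs)) /= big_cons subrr modulus0 !mul0r.
  by rewrite ltxx.
apply: IH; rewrite lt_neqAle distprod_ge0 andbT eq_sym.
by apply: contraTneq h => ->; rewrite mulr0 ltxx.
Qed.

Definition distprods F n : set R :=
  [set distprod s | s in [set s | size s = n /\ forall x, x \in s -> F x]].

Definition sup_distprod F n : R := sup (distprods F n).

Lemma lagrange_interpolation s (q : {poly R[i]}) w :
  uniq s -> (size q <= size s)%N ->
  q.[w] = \sum_(x <- s) q.[x] * \prod_(y <- rem x s) ((w - y) / (x - y)).
Proof.
move=> us qs.
pose l x : {poly R[i]} := \prod_(y <- rem x s) ((x - y)^-1 *: ('X - y%:P)).
have lE x v : (l x).[v] = \prod_(y <- rem x s) ((v - y) / (x - y)).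
  by rewrite /l horner_prod; apply: eq_bigr => y _; rewrite !hornerE mulrC.
have ls x : x \in s -> (size (l x) <= size s)%N.
  move=> xs; rewrite /l scaler_prod; apply: leq_trans (size_scale_leq _ _) _.
  by rewrite size_prod_XsubC size_rem// prednK//; case: (s) xs.
pose p := \sum_(x <- s) q.[x] *: l x.
suff: q - p = 0.
  move/eqP; rewrite subr_eq0 => /eqP {1}->; rewrite /p horner_sum.
  by apply: eq_bigr => x _; rewrite hornerZ lE.
apply/eqP; apply: contraT => qp0.
have pS : (size p <= size s)%N.
  rewrite /p big_seq; elim/big_ind: _ => [|a b ha hb|x xs].
  - by rewrite size_poly0.
  - by apply: leq_trans (size_polyD _ _) _; rewrite geq_max ha.
  - exact: leq_trans (size_scale_leq _ _) (ls x xs).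
have qpS : (size (q - p)%R <= size s)%N.
  by apply: leq_trans (size_polyD _ _) _; rewrite size_polyN geq_max qs.
rewrite -(leq_gtF qpS); apply: (max_poly_roots qp0 _ us).
apply/allP => v vs; rewrite /root !hornerE subr_eq0 /p horner_sum; apply/eqP.
rewrite (big_rem v)//= big_seq big1 ?addr0 => [|x].
  rewrite hornerZ lE big_seq big1 ?mulr1// => y.
  rewrite mem_rem_uniq// inE => /andP[yv _]; rewrite divff// subr_eq0 eq_sym//.
rewrite mem_rem_uniq// inE => /andP[xv xs].
rewrite hornerZ lE (big_rem v) /= ?subrr ?mul0r ?mulr0//.
by rewrite mem_rem_uniq// inE eq_sym xv.
Qed.

Section FeketePolynomials.
Variables (F : set R[i]) (M : R).
Hypothesis M1 : 1 <= M.
Hypothesis FM : forall z, F z -> modulus z <= M.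
Hypothesis Finf : forall n, exists s,
  [/\ uniq s, size s = n & forall x, x \in s -> F x].

Lemma prod_modulusB_le s x : F x -> (forall y, y \in s -> F y) ->
  \prod_(y <- s) modulus (x - y) <= (2 * M) ^+ size s.
Proof.
move=> Fx; elim: s => [|y s IH] sF; first by rewrite big_nil.
rewrite big_cons exprS; apply: ler_pM; rewrite ?modulus_ge0//.
- by apply: prodr_ge0 => ? _; exact: modulus_ge0.
- have := modulusD x (- y); rewrite modulusN.
  by have := FM Fx; have := FM (sF y (mem_head _ _)); lra.
- by apply: IH => z zs; apply: sF; rewrite inE zs orbT.
Qed.

Lemma distprods_nonempty n : distprods F n !=set0.
Proof. by have [s [us sn sF]] := Finf n; exists (distprod s), s. Qed.

Lemma distprods_ubound n : has_ubound (distprods F n).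
Proof.
elim: n => [|n [b bub]].
  by exists 1 => _ [s [/size0nil -> _] <-].
exists ((2 * M) ^+ n * b) => _ [[|x s] [//= [sn] sF] <-] /=.
have sF' y : y \in s -> F y by move=> ys; apply: sF; rewrite inE ys orbT.
apply: ler_pM.
- by apply: prodr_ge0 => ? _; exact: modulus_ge0.
- exact: distprod_ge0.
- by rewrite -sn; apply: prod_modulusB_le => //; apply: sF; rewrite inE eqxx.
- by apply: bub; exists s.
Qed.

Lemma distprod_le_sup s : (forall x, x \in s -> F x) ->
  distprod s <= sup_distprod F (size s).
Proof. by move=> sF; apply: ub_le_sup; [exact: distprods_ubound|exists s]. Qed.

Lemma sup_distprod_gt0 n : 0 < sup_distprod F n.
Proof.
have [s [us <- sF]] := Finf n.
exact: lt_le_trans (distprod_gt0 us) (distprod_le_sup sF).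
Qed.

Lemma sup_distprodS n : sup_distprod F n.+1 <= (2 * M) ^+ n * sup_distprod F n.
Proof.
apply: ge_sup; first exact: distprods_nonempty.
move=> _ [[|x s] [//= [sn] sF] <-] /=.
have sF' y : y \in s -> F y by move=> ys; apply: sF; rewrite inE ys orbT.
apply: ler_pM.
- by apply: prodr_ge0 => ? _; exact: modulus_ge0.
- exact: distprod_ge0.
- by rewrite -sn; apply: prod_modulusB_le => //; apply: sF; rewrite inE eqxx.
- by rewrite -sn; exact: distprod_le_sup.
Qed.

(** Up to the factor [2], [s] is a system of Fekete points of [F]. This factor is
    harmless and avoids asking that the supremum be attained. *)
Lemma near_fekete n : exists s, [/\ uniq s, size s = n,
  forall x, x \in s -> F x & sup_distprod F n <= 2 * distprod s].
Proof.
have v0 := sup_distprod_gt0 n.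
have v2 : 0 < sup_distprod F n / 2 by rewrite divr_gt0.
have [_ [s [sn sF] <-] h] :=
  sup_adherent v2 (conj (distprods_nonempty n) (distprods_ubound n)).
rewrite -/(sup_distprod F n) in h.
exists s; split=> //; last lra.
by apply: distprod_uniq; lra.
Qed.

Definition fekete_poly s : {poly R[i]} := \prod_(y <- s) ('X - y%:P).

Lemma modulus_fekete_poly s z :
  modulus (fekete_poly s).[z] = \prod_(y <- s) modulus (z - y).
Proof.
rewrite /fekete_poly horner_prod; elim: s => [|y s IH].
  by rewrite !big_nil modulus1.
by rewrite !big_cons modulusM IH !hornerE.
Qed.

(** The product of the left-hand side is the product of the mutual distances of
    [z :: s]. *)
Lemma fekete_upper s z : F z -> (forall x, x \in s -> F x) ->
  modulus (fekete_poly s).[z] * distprod s <= sup_distprod F (size s).+1.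
Proof.
move=> Fz sF; rewrite modulus_fekete_poly -[_ * _]/(distprod (z :: s)).
rewrite -[(size s).+1]/(size (z :: s)).
by apply: distprod_le_sup => x; rewrite inE => /orP[/eqP ->//|]; exact: sF.
Qed.

(** Interpolate [q] at the points of [s]. The Lagrange polynomial at [x \in s] is,
    in modulus at [w], the quotient of [modulus (fekete_poly s).[w]] by
    [modulus (w - x)], which is at least [d], and by the product of the distances
    from [x] to the other points, which is [distprod s / distprod (rem x s)]. *)
Lemma fekete_lower s (q : {poly R[i]}) w (d : R) n : 0 < d ->
  uniq s -> size s = n.+1 -> (forall x, x \in s -> F x) ->
  (forall z, F z -> d <= modulus (z - w)) ->
  (size q <= n.+1)%N -> (forall z, F z -> modulus q.[z] <= 1) ->
  modulus q.[w] * (d * distprod s) <=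
    n.+1%:R * sup_distprod F n * modulus (fekete_poly s).[w].
Proof.
move=> d0 us sn sF dF qn qF.
rewrite (lagrange_interpolation w us) ?sn//.
have tri (r : seq R[i]) (f : R[i] -> R[i]) :
    modulus (\sum_(x <- r) f x) <= \sum_(x <- r) modulus (f x).
  elim: r => [|x r IH]; first by rewrite !big_nil modulus0.
  by rewrite !big_cons; apply: le_trans (modulusD _ _) _; rewrite lerD2l.
have dv0 : 0 < d * distprod s by rewrite mulr_gt0// distprod_gt0.
apply: le_trans (ler_wpM2r (ltW dv0) (tri _ _)) _.
rewrite mulr_suml -sn -sum1_size natr_sum !mulr_suml big_seq [leRHS]big_seq.
apply: ler_sum => x xs; rewrite mul1r modulusM.
have Fx := sF x xs.
have modprod (r : seq R[i]) : modulus (\prod_(y <- r) ((w - y) / (x - y))) =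
    (\prod_(y <- r) modulus (w - y)) / (\prod_(y <- r) modulus (x - y)).
  elim: r => [|y r IH]; first by rewrite !big_nil modulus1 divr1.
  by rewrite !big_cons modulusM IH modulusM modulusV invfM; ring.
rewrite modprod modulus_fekete_poly [in leRHS](big_rem x)//= (distprod_rem xs).
set a := \prod_(y <- rem x s) modulus (w - y).
set b := \prod_(y <- rem x s) modulus (x - y).
have b0 : 0 < b.
  rewrite /b big_seq; apply: prodr_gt0 => y; rewrite mem_rem_uniq// inE => /andP[yx _].
  by rewrite modulus_gt0 subr_eq0 eq_sym.
have a0 : 0 <= a by apply: prodr_ge0 => ? _; exact: modulus_ge0.
have -> : modulus q.[x] * (a / b) * (d * (b * distprod (rem x s))) =
   modulus q.[x] * (distprod (rem x s) * (d * a)).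
  by field; rewrite gt_eqF.
apply: (@le_trans _ _ (1 * (distprod (rem x s) * (d * a)))).
  by rewrite ler_wpM2r ?qF// mulr_ge0 ?distprod_ge0// mulr_ge0// ltW.
rewrite mul1r; apply: ler_pM; rewrite ?distprod_ge0//.
- by rewrite mulr_ge0// ltW.
- have -> : n = size (rem x s) by rewrite size_rem// sn.
  by apply: distprod_le_sup => y; rewrite mem_rem_uniq// inE => /andP[_]; exact: sF.
- by rewrite ler_wpM2r// modulusBC dF.
Qed.

(** Hilbert's lemniscate theorem, [G] being the outside of the lemniscate. With
    [m] about [n / k], the power [q ^+ m] can be interpolated at [n.+1] points, and
    [2 ^+ m] beats the factor, linear in [n], that is lost between [fekete_upper]
    and [fekete_lower]; [n] is chosen so that the suprema for [n], [n.+1] and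
    [n.+2] points are balanced. *)
Lemma lemniscate (G : set R[i]) (d : R) k : 0 < d ->
  (forall z w, F z -> G w -> d <= modulus (z - w)) ->
  (forall w, G w -> exists q : {poly R[i]},
    [/\ (size q <= k)%N, forall z, F z -> modulus q.[z] <= 1 &
        2 <= modulus q.[w]]) ->
  exists Q : {poly R[i]}, (forall z, F z -> modulus Q.[z] <= 1 / 2) /\
    (forall w, G w -> 2 <= modulus Q.[w]).
Proof.
move=> d0 dFG Gq.
have [K KE] : exists K : R, K = 2 * M by exists (2 * M).
have vK := sup_distprodS; rewrite -KE in vK.
have K1 : 1 <= K by move: M1 KE; lra.
(* In the end [modulus (fekete_poly s).[w] >= 4 * mu] is needed; the constant [64]
   gives twice as much. *)
pose A := 64 * K / d * k.+1%:R.
have A0 : 0 <= A by rewrite mulr_ge0// divr_ge0 ?ltW//; lra.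
have [m0 Hm0] := exp_beats_linear A0.
have [n Nn ratio] := slowly_growing_ratio K1 sup_distprod_gt0 vK (m0 * k.+1)%N.
have [s [us sn sF sv]] := near_fekete n.+1.
pose m := (n %/ k.+1)%N.
have m0m : (m0 <= m)%N by rewrite /m leq_divRL.
have nm : (n < m.+1 * k.+1)%N by rewrite /m ltn_ceil.
have mn : (m * k.+1 <= n)%N by rewrite /m leq_divM.
have vs0 := distprod_gt0 us.
have v0 := sup_distprod_gt0 n; have v1 := sup_distprod_gt0 n.+1.
have v2 := sup_distprod_gt0 n.+2.
(* The bound that [fekete_upper] gives for [fekete_poly s] on [F]. *)
pose mu := sup_distprod F n.+2 / distprod s; have mu0 : 0 < mu by exact: divr_gt0.
have mu2 : 0 < 2 * mu by rewrite pmulr_rgt0.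
exists (((2 * mu)^-1)%:C *: fekete_poly s); split=> [z Fz|w Gw].
  rewrite hornerZ modulusM modulus_real ger0_norm; last by rewrite invr_ge0 ltW.
  rewrite mulrC ler_pdivrMr//.
  have -> : 1 / 2 * (2 * mu) = mu by field.
  by rewrite ler_pdivlMr// -[in leRHS]sn; exact: fekete_upper.
have [q [qk qF qw]] := Gq w Gw.
have qmS : (size (q ^+ m)%R <= n.+1)%N.
  apply: leq_trans (size_poly_exp_leq _ _) _; rewrite ltnS; apply: leq_trans mn.
  by rewrite mulnC leq_mul2l (leq_trans (leq_pred _) (leqW qk)) orbT.
have qmF z : F z -> modulus (q ^+ m).[z] <= 1.
  by move=> /qF qz; rewrite horner_exp modulusX exprn_ile1 ?modulus_ge0.
have := fekete_lower d0 us sn sF (fun z Fz => dFG z w Fz Gw) qmS qmF.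
rewrite horner_exp modulusX hornerZ modulusM modulus_real ger0_norm; last first.
  by rewrite invr_ge0 ltW.
have := modulus_ge0 (fekete_poly s).[w].
move: (modulus (fekete_poly s).[w]) => f f0 low.
have qA : A * m.+1%:R <= modulus q.[w] ^+ m.
  by apply: le_trans (Hm0 m m0m) _; apply: lerXn2r; rewrite ?nnegrE ?modulus_ge0.
have big : 64 * K / d * n.+1%:R <= modulus q.[w] ^+ m.
  apply: le_trans qA; rewrite /A -[leRHS]mulrA -natrM ler_wpM2l ?ler_nat//.
    by rewrite divr_ge0 ?ltW//; lra.
  by rewrite mulnC.
have K0 : 0 < K by lra.
have step1 : 64 * K * distprod s <= sup_distprod F n * f.
  have n0 : 0 < n.+1%:R :> R by [].
  rewrite -(ler_pM2l n0) [leRHS]mulrA; apply: le_trans low.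
  have -> : n.+1%:R * (64 * K * distprod s) = 64 * K / d * n.+1%:R * (d * distprod s).
    by field; rewrite gt_eqF.
  by rewrite ler_wpM2r// mulr_ge0// ltW.
have step2 : 64 * K * distprod s * sup_distprod F n.+2 <= 8 * K * distprod s ^+ 2 * f.
  apply: (@le_trans _ _ (sup_distprod F n * f * sup_distprod F n.+2)).
    by rewrite ler_pM2r.
  have -> : sup_distprod F n * f * sup_distprod F n.+2 =
      sup_distprod F n.+2 * sup_distprod F n * f by ring.
  apply: ler_wpM2r => //; apply: (le_trans ratio).
  have -> : 8 * K * distprod s ^+ 2 = 2 * K * (2 * distprod s) ^+ 2 by ring.
  rewrite ler_pM2l ?mulr_gt0//; apply: lerXn2r => //.
    by rewrite nnegrE ltW.
  by rewrite nnegrE mulr_ge0// ltW.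
have step3 : 8 * sup_distprod F n.+2 <= distprod s * f.
  have p0 : 0 < 8 * K * distprod s by rewrite !mulr_gt0.
  rewrite -(ler_pM2l p0); apply: le_trans (le_trans step2 _).
    by rewrite le_eqVlt; apply/orP; left; apply/eqP; ring.
  by rewrite le_eqVlt; apply/orP; left; apply/eqP; ring.
rewrite mulrC ler_pdivlMr// /mu.
have -> : 2 * (2 * (sup_distprod F n.+2 / distprod s)) =
    4 * sup_distprod F n.+2 / distprod s by ring.
rewrite ler_pdivrMr//; lra.
Qed.
End FeketePolynomials.

End Fekete.

(** * From a lemniscate to a filled Julia set, and Hausdorff distances *)

Section Dynamics.
Variable R : realType.
Implicit Types (x y z w c : R[i]) (F E : set R[i]).

(** The polynomial is [c + ('X - c) * Q ^+ N], with [N] such that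
    [2 M < r 2 ^+ N]; here [2 M] bounds the distance from [c] to the points of [E].
    It maps [F] into the disc of radius [r] around [c], hence into [F]. Off [E] it
    at least doubles the distance to [c] and makes it larger than [2 M], so that
    the image is again off [E]. *)
Lemma lemniscate_filled_julia (Q : {poly R[i]}) F E c (r M : R) :
  0 < r -> F `<=` E -> (forall z, E z -> modulus z <= M) ->
  (forall z, modulus (z - c) <= r -> F z) ->
  (forall z, F z -> modulus Q.[z] <= 1 / 2) ->
  (forall z, ~ E z -> 2 <= modulus Q.[z]) ->
  exists P : {poly R[i]}, F `<=` filled_julia P /\ filled_julia P `<=` E.
Proof.
move=> r0 FE EM cF QF QE.
have Fc : F c by apply: cF; rewrite subrr modulus0 ltW.
have dE z : E z -> modulus (z - c) <= 2 * M.
  move=> /EM zM; have := EM _ (FE _ Fc).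
  by have := modulusD z (- c); rewrite modulusN; lra.
pose N := (Num.truncn (2 * M / r)).+1.
have MN : 2 * M < r * 2 ^+ N.
  rewrite [ltRHS]mulrC -ltr_pdivrMr//; apply: lt_le_trans (truncnS_gt _) _.
  by rewrite -natrX ler_nat ltnW// ltn_expl.
exists (c%:P + ('X - c%:P) * Q ^+ N); set P := (X in filled_julia X).
have PE z : modulus (P.[z] - c) = modulus (z - c) * modulus Q.[z] ^+ N.
  by rewrite /P !hornerE addrC addKr modulusM modulusX.
split=> z Hz.
- have itF m : F (iter m (horner P) z).
    elim: m => [//|m IH] /=; apply: cF; rewrite PE.
    apply: (@le_trans _ _ (2 * M * (1 / 2) ^+ N)).
      apply: ler_pM; rewrite ?modulus_ge0 ?exprn_ge0 ?modulus_ge0//; first exact/dE/FE.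
      by apply: lerXn2r; rewrite ?nnegrE ?modulus_ge0// ?QF//; lra.
    by rewrite mul1r exprVn ler_pdivrMr ?exprn_gt0// ltW.
  move=> /cvgryPgt /(_ M)[m _ /(_ m (leqnn m))] /=.
  by rewrite ltNge EM//; exact/FE/itF.
- apply: contrapT => Ez; apply: Hz.
  have it m : ~ E (iter m (horner P) z) /\
      r * 2 ^+ m <= modulus (iter m (horner P) z - c).
    elim: m => [|m [nE IH]] /=.
      split=> //; rewrite expr0 mulr1 leNgt; apply/negP => /ltW/cF/FE; exact: Ez.
    set u := iter m _ _ in nE IH *.
    have ur : r <= modulus (u - c).
      by apply: le_trans IH; rewrite ler_peMr ?(ltW r0)// exprn_ege1// ler1n.
    have Q2 : 2 ^+ N <= modulus Q.[u] ^+ N.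
      by apply: lerXn2r; rewrite ?nnegrE ?modulus_ge0// QE.
    split.
      move=> /dE; rewrite PE; apply/negP; rewrite -ltNge; apply: lt_le_trans MN _.
      by apply: ler_pM; rewrite ?exprn_ge0// ltW.
    rewrite PE exprSr mulrA; apply: ler_pM; rewrite ?mulr_ge0 ?exprn_ge0 ?(ltW r0)//.
    by apply: le_trans Q2; rewrite -[leLHS]expr1 ler_weXn2l ?ler1n.
  apply/cvgryPge => A.
  exists (Num.truncn ((A + modulus c) / r)) => // m /= mA.
  have [_ h] := it m.
  have : A + modulus c <= r * 2 ^+ m.
    rewrite [leRHS]mulrC -ler_pdivrMr//; apply: le_trans (ltW (truncnS_gt _)) _.
    by rewrite -natrX ler_nat (leq_ltn_trans mA)// ltn_expl.
  have := modulusD (iter m (horner P) z) (- c); rewrite modulusN; lra.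
Qed.

End Dynamics.

Section HausdorffApproximation.
Variable R : realType.
Implicit Types (x y z w c : R[i]) (K E : set (cplx R)).

Lemma core_mono E (d d' : R) : d' <= d -> core E d `<=` core E d'.
Proof. by move=> dd z Hz w /Hz; exact: le_trans. Qed.

Lemma open_core E z : open E -> E z -> exists2 d : R, 0 < d & core E d z.
Proof.
move=> oE Ez.
have /nbhs_modulusP[d d0 Hd] : nbhs (z : cplx R) E by exact: open_nbhs_nbhs.
exists d => // w Ew; rewrite leNgt; apply/negP => zw; apply: Ew; apply: Hd.
by rewrite modulusBC.
Qed.

Lemma closure_modulus E (z : cplx R) (e : R) : 0 < e -> closure E z ->
  exists2 p, E p & modulus ((p : R[i]) - z) < e.
Proof.
move=> e0 /(_ [set v : cplx R | modulus ((v : R[i]) - z) < e])[].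
  by apply/nbhs_modulusP; exists e.
by move=> p [Ep pz]; exists p.
Qed.

(** Each point of the compact closure of [E] is close to a point of [E], which
    belongs to some core; the cores grow when [d] decreases. *)
Lemma core_approximation E (M r : R) : open E -> (forall z, E z -> modulus z <= M) ->
  0 < r ->
  exists2 d : R, 0 < d & forall z, closure E z ->
    exists2 p, core E d p & modulus (p - z) < r.
Proof.
move=> oE EM r0.
have cE : compact (closure E).
  apply: (@closed_bounded_compact _ _ (M + 1)); first exact: closed_closure.
  move=> z /(closure_modulus ltr01)[p Ep pz].
  have := modulus_sub_ge z p; have := EM _ Ep; rewrite modulusBC in pz; lra.
have [|k Hk] := @compact_uniform_index R _
    (fun k z => exists2 p, core E (k.+1%:R^-1) p & modulus (p - z) < r) cE.
  have r2 : 0 < r / 2 by rewrite divr_gt0.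
  move=> z /(closure_modulus r2)[p Ep pz]; have [d d0 pd] := open_core oE Ep.
  exists (Num.truncn d^-1), (r / 2) => // w wz k dk; exists p.
    apply: core_mono pd; rewrite -[leRHS]invrK lef_pV2 ?posrE ?invr_gt0//.
    by apply: le_trans (ltW (truncnS_gt _)) _; rewrite ler_nat.
  have := modulus_triangle p z w; rewrite (modulusBC z w); lra.
by exists k.+1%:R^-1 => //; rewrite invr_gt0.
Qed.

Lemma boundary_on_segment (A : set (cplx R)) x y : A x -> ~ A y ->
  exists2 p, boundary A p & segment x y p.
Proof.
move=> Ax Ay; apply: contrapT => nop.
have inter z : segment x y z -> closure A z -> interior A z.
  by move=> xyz Az; apply: contrapT => nz; apply: nop; exists z.
have : segment x y `&` interior A = segment x y.
  apply: connected_segment.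
  - exists x; have xs := @segment_l R x y; split=> //; apply: inter => //.
    exact: subset_closure.
  - by exists (interior A) => //; exact: open_interior.
  - exists (closure A); first exact: closed_closure.
    apply/seteqP; split=> z [xyz Az]; split=> //; last exact: inter.
    by apply: subset_closure; exact: interior_subset Az.
by move/seteqP => [_ /(_ y (@segment_r R x y))[_ /interior_subset]].
Qed.

Lemma hausdorff_dist_lt (T : Type) (dist : T -> T -> \bar R) (A B : set T) (r e : R) :
  0 < r -> r < e ->
  (forall a, A a -> exists2 b, B b & (dist a b <= r%:E)%E) ->
  (forall b, B b -> exists2 a, A a & (dist b a <= r%:E)%E) ->
  (hausdorff_dist dist A B < e%:E)%E.
Proof.
move=> r0 re AB BA; apply: (@le_lt_trans _ _ r%:E); last by rewrite lte_fin.
by apply: ereal_inf_lbound; exists r.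
Qed.

(** A point of the boundary of [E] is close to a point of the core, hence of [K],
    and is not in [K]. A point of the boundary of [K] is in the closure of [E] and
    close to a point off the core, hence to a point off [E]. In both cases the
    segment between the two points meets the other boundary. *)
Lemma hausdorff_core_approximation E K (d r e : R) :
  open E -> 0 < d -> d <= r / 2 -> 0 < r -> r < e ->
  (forall z, closure E z -> exists2 p, core E d p & modulus (p - z) < r) ->
  core E d `<=` K -> K `<=` E ->
  [/\ (hausdorff_dist (@plane_dist R) E K < e%:E)%E,
      (hausdorff_dist (@plane_dist R) (boundary E) (boundary K) < e%:E)%E &
      (hausdorff_dist (@sphere_dist R) (sphere_compl E) (sphere_compl K) < e%:E)%E].
Proof.
move=> oE d0 dr r0 re approx FK KE.
have near0 (z : R[i]) : modulus (z - z) <= r by rewrite subrr modulus0 ltW.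
have far z : ~ core E d z -> exists2 w, ~ E w & modulus (z - w) < d.
  move=> nz; apply: contrapT => now; apply: nz => w Ew.
  by rewrite leNgt; apply/negP => zw; apply: now; exists w.
split; apply: (hausdorff_dist_lt r0 re).
- move=> a Ea; have [p Fp pa] := approx a (subset_closure Ea).
  by exists p; [exact: FK|rewrite /plane_dist lee_fin modulusBC ltW].
- by move=> b /KE Eb; exists b => //; rewrite /plane_dist lee_fin near0.
- move=> z [cEz]; rewrite (iffLR (interior_id _) oE) => Ez.
  have [p Fp pz] := approx z cEz.
  have [q Kq pzq] : exists2 q, boundary K q & segment p z q.
    by apply: boundary_on_segment; [exact: FK|move=> /KE].
  exists q => //; rewrite /plane_dist lee_fin modulusBC.
  by apply: le_trans (segment_dist_r pzq) _; rewrite modulusBC ltW.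
- move=> z [cKz iKz].
  have [Ez|Ez] := pselect (E z); last first.
    exists z; last by rewrite /plane_dist lee_fin near0.
    split; first exact: closureS cKz.
    by move=> /interior_subset.
  have [z' z'z Fz'] : exists2 z', modulus (z' - z) < r / 2 & ~ core E d z'.
    apply: contrapT => noz; apply: iKz; apply/nbhs_modulusP; exists (r / 2).
      by rewrite divr_gt0.
    move=> w wz; apply: FK; apply: contrapT => Fw; apply: noz; by exists w.
  have [w Ew z'w] := far z' Fz'.
  have [q Eq zwq] := boundary_on_segment Ez Ew.
  exists q => //; rewrite /plane_dist lee_fin modulusBC.
  apply: le_trans (segment_dist_l zwq) _; rewrite modulusBC.
  have := modulus_triangle z z' w; rewrite (modulusBC z z'); lra.
- move=> [a|] Ha; last by exists None; [move=> []|rewrite /= lee_fin ltW].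
  exists (Some a); last by rewrite /= /plane_dist lee_fin near0.
  by move=> [b Kb ba]; apply: Ha; exists b => //; exact: KE.
- move=> [b|] Hb; last by exists None; [move=> []|rewrite /= lee_fin ltW].
  have /far[w Ew bw] : ~ core E d b by move=> /FK Kb; apply: Hb; exists b.
  exists (Some w); first by move=> [v Ev [vw]]; apply: Ew; rewrite -vw.
  by rewrite /= /plane_dist lee_fin; lra.
Qed.

End HausdorffApproximation.

(** * Assembly *)

Section Assembly.
Variable R : realType.
Implicit Types (x y z w c : R[i]) (E : set (cplx R)).

Lemma ball_points c (r : R) n : 0 < r -> exists s : seq R[i],
  [/\ uniq s, size s = n & forall x, x \in s -> modulus (x - c) <= r].
Proof.
move=> r0; pose f (i : nat) : R[i] := c + (r / i.+1%:R)%:C.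
exists [seq f i | i <- iota 0 n]; split; rewrite ?size_map ?size_iota//.
  rewrite map_inj_uniq ?iota_uniq// => i j /addrI/(congr1 (@complex.Re R)) /=.
  by move=> /(mulfI (lt0r_neq0 r0))/invr_inj/eqP; rewrite eqr_nat eqSS => /eqP.
move=> _ /mapP[i _ ->].
rewrite /f addrC addKr modulus_real ger0_norm ?divr_ge0 ?(ltW r0)//.
by rewrite ler_pdivrMr// ler_peMr ?(ltW r0)// ler1n.
Qed.

Lemma closed_ball_compact (M : R) : compact [set z : cplx R | modulus z <= M].
Proof.
apply: (@closed_bounded_compact _ _ M) => //.
rewrite -[X in closed X]setCK; apply: open_closedC; rewrite openE => z /= /negP.
rewrite -ltNge => Mz; apply/nbhs_modulusP; exists (modulus z - M); first lra.
move=> w wz /=; apply/negP; rewrite -ltNge.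
by have := modulus_sub_ge z w; rewrite (modulusBC z); lra.
Qed.

(** Separating polynomials of bounded degree exist for all [w] off [E]: by
    compactness when [modulus w <= 2 * M], and otherwise ['X] divided by [M]
    serves. *)
Lemma polynomially_convex_lemniscate E F c (M d r : R) :
  open E -> 0 < d -> 0 < r -> 1 <= M ->
  (forall z, F z -> modulus z <= M) ->
  (forall z, modulus (z - c) <= r -> F z) ->
  (forall z w, F z -> ~ E w -> d <= modulus (z - w)) ->
  (forall w, ~ E w -> poly_separated F w) ->
  exists Q : {poly R[i]}, (forall z, F z -> modulus Q.[z] <= 1 / 2) /\
    (forall w, ~ E w -> 2 <= modulus Q.[w]).
Proof.
move=> oE d0 r0 M1 FM cF dFE pF.
have cK : compact (~` E `&` [set z : cplx R | modulus z <= 2 * M]).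
  rewrite setIC; apply: compact_closedI; first exact: closed_ball_compact.
  exact: open_closedC.
have [k Hk] := poly_separated_uniform cK (fun w Kw => pF w Kw.1).
have Finf n : exists s, [/\ uniq s, size s = n & forall x, x \in s -> F x].
  have [s [us sn sc]] := ball_points c n r0.
  by exists s; split=> // x /sc; exact: cF.
apply: (@lemniscate R F M M1 FM Finf (~` E) d (maxn k 2) d0 dFE) => w Ew.
have [wM|wM] := leP (modulus w) (2 * M).
  have [q [qk qF qw]] := Hk w (conj Ew wM).
  by exists q; split=> //; rewrite leq_max qk.
have MC : modulus (M^-1%:C : R[i]) = M^-1.
  by rewrite modulus_real ger0_norm// invr_ge0; lra.
have M0 : 0 < M by lra.
exists (M^-1%:C *: 'X); split.
- apply: leq_trans (size_scale_leq _ _) _; by rewrite size_polyX leq_maxr.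
- by move=> z /FM zM; rewrite hornerZ hornerX modulusM MC mulrC ler_pdivrMr// mul1r.
- by rewrite hornerZ hornerX modulusM MC mulrC ler_pdivlMr// ltW.
Qed.

End Assembly.

Theorem theorem1p1 (R : realType) (n : nat) (D : 'I_n -> set (cplx R))
    (E : set (cplx R)) (D_jordan : forall i, jordan_domain (D i))
    (D_disjoint : trivIset [set: 'I_n] D)
    (E_union : E = \bigcup_(i in [set: 'I_n]) D i)
    (E_nonempty : E !=set0) (eps : R) (eps_gt0 : 0 < eps) :
  exists P : {poly R[i]},
    [/\ (hausdorff_dist (@plane_dist R) E (filled_julia P) < eps%:E)%E,
        (hausdorff_dist (@plane_dist R) (boundary E) (julia P) < eps%:E)%E &
        (hausdorff_dist (@sphere_dist R)
           (sphere_compl E) (sphere_compl (filled_julia P)) < eps%:E)%E].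
Proof.
have [M M1 EM] : exists2 M : R, 1 <= M & forall z, E z -> modulus z <= M.
  have /choice[m mP] : forall i, exists M : R,
      0 < M /\ forall z, D i z -> modulus z <= M.
    move=> i; have [_ [_ _ /bounded_set_modulus[M M0 DM]]] := D_jordan i.
    by exists M.
  exists (1 + \sum_i m i); first rewrite lerDl sumr_ge0//.
    by move=> i _; have [/ltW] := mP i.
  rewrite E_union => z [i _ /(mP i).2] /le_trans; apply.
  rewrite (bigD1 i)//= addrCA lerDl addr_ge0// sumr_ge0// => j _.
  by have [/ltW] := mP j.
have oE : open E.
  by rewrite E_union; apply: bigcup_open => i _; exact: jordan_domain_open.
have [c Ec] := E_nonempty.
have [h h0 hc] := open_core oE Ec.
have r0 : 0 < eps / 2 by rewrite divr_gt0.
have [d' d'0 approx] := core_approximation oE EM r0.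
(* [d'] makes the core dense in [E] at scale [eps / 2], [h / 2] leaves room for a
   disc around [c] inside the core, and [eps / 4] is half of the accuracy [eps / 2]
   wanted for the boundary of the filled Julia set. *)
pose d := Num.min d' (Num.min (h / 2) (eps / 4)).
have [dd' dh de] : [/\ d <= d', d <= h / 2 & d <= eps / 4].
  by rewrite /d !ge_min !lexx !orbT.
have d0 : 0 < d by rewrite /d !lt_min d'0 !divr_gt0.
have ball_core (z : R[i]) : modulus (z - c) <= h / 2 -> core E d z.
  move=> zc w Ew; have := hc w Ew.
  by have := modulus_triangle c z w; rewrite (modulusBC c z); lra.
have FM z : core E d z -> modulus z <= M by move=> /(core_sub d0)/EM.
have pF w : ~ E w -> poly_separated (core E d) w.
  rewrite E_union in EM *; apply: (@jordan_domains_separated R _ D M d w) => //.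
  exact: lt_le_trans ltr01 M1.
have h2 : 0 < h / 2 by rewrite divr_gt0.
have [Q [QF QE]] := polynomially_convex_lemniscate oE d0 h2 M1 FM ball_core
  (fun z w Fz Ew => Fz w Ew) pF.
have [P [FP PE]] := lemniscate_filled_julia h2 (core_sub d0) EM ball_core QF QE.
have small : d <= eps / 2 / 2 by lra.
have half : eps / 2 < eps by lra.
exists P; apply: (hausdorff_core_approximation oE d0 small r0 half _ FP PE).
by move=> z /approx[p Fp pz]; exists p => //; exact: core_mono dd' _ Fp.
Qed.
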